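(* Consider the Retrospective Approximation (RA) algorithm described in the context. Suppose that, for constants $\rho<1$ and $C<\infty$ and every $k\ge1$, the solver, when executed on the problem of minimizing $f_{M_k}$ starting at $X_{k-1}$, is $(\rho_{M_k},C_{M_k})$-linearly convergent, i.e. its inner iterates satisfy $$\|\nabla f_{M_k}(X_{k-1,t})\|\le C_{M_k}\,\|\nabla f_{M_k}(X_{k-1})\|\,\rho_{M_k}^{\,t},\qquad t\ge 0,$$ where $0<\rho_{M_k}\le\rho$ and $C_{M_k}\le C$. Let $M_1=m_1$ and $$M_k=c_1M_{k-1}\ (k\ge2),\quad 1<c_1<\infty;\qquad \epsilon_k=\frac{C_{2,k}}{\sqrt{M_k}},\quad C_{2,k}\in[\underline c_2,c_2],\quad 0<\underline c_2\le c_2<\infty,$$ where $C_{2,k}$ is $\mathcal{F}_{k-1}$-measurable and $c_1,\underline c_2,c_2$ are non-random constants. Suppose there is $\sigma<\infty$ with $\mathbb{E}\left[(\sqrt{M_k}\,G_{M_k})^2\mid\mathcal{F}_{k-1}\right]\le\sigma^2$ for all $k\ge1$. Suppose further that one of the following holds. (I) $\sup_{x\in\mathbb{R}^d}\|R_m(x)\|\to0$ almost surely as $m\to\infty$, $\mathbb{E}[G^2(Y)]<\infty$, and $\sup_k\mathbb{E}[\|\nabla f(X_k)\|^2\mid\mathcal{F}_{k-1}]\le\ell_{2,\infty}^2$ for a constant $\ell_{2,\infty}<\infty$. In this case set $$A:=\frac{\sqrt{c_1}\,(c_2+c_0\sigma+\sigma\ell_{2,\infty})}{\sqrt{m_1}}.$$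 (II) For some $\alpha\in(0,1)$, $\delta_0>0$ and $\sigma_0<\infty$, $\mathbb{E}\left[(\sqrt{M_k}\,H_{M_k})^{1/\alpha}\mid\mathcal{F}_{k-1}\right]\le\sigma_0^{1/\alpha}$ for all $k$, where $H_m:=\sup_{x\in\mathbb{R}^d}\|R_m(x)\|(\|\nabla f(x)\|^\alpha+\delta_0)$. In this case set $$A:=\sqrt{c_1}\left(\frac{2(c_2+c_0\sigma_0/\delta_0)}{\sqrt{m_1}}\right)+\left(\frac{\kappa_2}{\sqrt{m_1}}\right)^{1/\alpha},\qquad \kappa_2:=2(1-\alpha)\left(\frac{2\alpha}{1-\alpha}\right)^{\alpha}\sigma_0 .$$ Then an expected number of oracle calls of order $\frac{A^2m_1}{(c_1-1)\epsilon^2\log(1/\rho)}$ suffices for RA to reach expected gradient norm at most $\epsilon$: for each sufficiently small $\epsilon>0$ there is an outer iteration $k=k(\epsilon)\ge1$ such that $\mathbb{E}\left[\|\nabla f(X_k)\|\right]\le\epsilon$ and $$\mathbb{E}[W_k]=O\left(\frac{A^2m_1}{(c_1-1)\,\epsilon^2\log(1/\rho)}\right)\quad\text{as }\epsilon\to0,$$ where the implied constant does not depend on $\epsilon$.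
   Context: Problem: minimize $f(x):=\mathbb{E}[F(x,Y)]$ over $x\in\mathbb{R}^d$, where $Y$ is a random variable with distribution $P$ on a measurable space $(\mathcal{Y},\mathcal{A})$, $F(\cdot,y)$ is a smooth function on $\mathbb{R}^d$ for every $y\in\mathcal{Y}$ with gradient $\nabla F(\cdot,y)$, and $\mathbb{E}[\nabla F(x,Y)]=\nabla f(x)$ for all $x$. $\|\cdot\|$ is the Euclidean norm. Sampling: $\{\tilde Y_j, j\ge1\}$ is an IID sequence of copies of $Y$. $M_1=m_1$ is a constant positive integer, $\mathcal{F}_0$ is trivial, $\mathcal{F}_k:=\sigma(\tilde Y_j: j\le \sum_{i=1}^k M_i)$, and the (positive-integer-valued) sample size $M_{k+1}$ is $\mathcal{F}_k$-measurable. At iteration $k$ the sample-path function and gradient are $$f_{M_k}(x):=\frac1{M_k}\sum_{j=1}^{M_k}F(x,Y_j),\qquad \nabla f_{M_k}(x):=\frac1{M_k}\sum_{j=1}^{M_k}\nabla F(x,Y_j),\qquad Y_j:=\tilde Y_{(\sum_{i=1}^{k-1}M_i)+j}.$$ RA algorithm: start from a (deterministic) initial guess $X_0$. At each outer iteration $k\ge1$, with $\mathcal{F}_{k-1}$-measurable $M_k$ and tolerance $\epsilon_k$, run an iterative deterministic solver on the problem of minimizing $f_{M_k}$ over $\mathbb{R}^d$ from $X_{k-1,0}:=X_{k-1}$, producing inner iterates $X_{k-1,t}$, $t=0,1,2,\dots$; let $N_k:=\min\{t:\|\nabla f_{M_k}(X_{k-1,t})\|\le\epsilon_k\}$ and set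 $X_k:=X_{k-1,N_k}$. The total number of oracle calls after $k$ outer iterations is $W_k:=\sum_{j=1}^kN_jM_j$. Relative error: fix $c_0>0$. $R(x,Y):=\frac{\nabla F(x,Y)-\nabla f(x)}{\|\nabla f(x)\|+c_0}$, with envelope $G(Y):=\sup_{x\in\mathbb{R}^d}\|R(x,Y)\|$. For $m\ge1$, $R_m(x):=\frac{\nabla f_m(x)-\nabla f(x)}{\|\nabla f(x)\|+c_0}$ with $\nabla f_m(x)=\frac1m\sum_{j=1}^m\nabla F(x,Y_j)$ and $Y_1,Y_2,\dots$ IID copies of $Y$; $G_m:=\sup_{x\in\mathbb{R}^d}\|R_m(x)\|$. $R_{M_k},G_{M_k},H_{M_k}$ denote these quantities formed with $\nabla f_{M_k}$, i.e. with the iteration-$k$ sample. *)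

(* Defs.v *)
From HB Require Import structures.
From mathcomp Require Import all_boot all_order all_algebra.
From mathcomp Require Import all_classical all_reals all_analysis.
From mathcomp Require Import measurable_realfun.
Set Implicit Arguments.
Unset Strict Implicit.
Unset Printing Implicit Defensive.
Import Order.TTheory GRing.Theory Num.Theory.
Import numFieldNormedType.Exports.
Local Open Scope classical_set_scope.
Local Open Scope ring_scope.

Section euclidean.
Context {R : realType} {d : nat}.
Implicit Types (x : 'rV[R]_d) (g : 'rV[R]_d -> R).

(* The norm [`|x|] of the library is the sup norm on ['rV[R]_d]. *)
Definition enorm x : R := Num.sqrt (\sum_(i < d) x 0 i ^+ 2).

Definition gradient g x : 'rV[R]_d := \row_(i < d) 'D_(delta_mx 0 i) g x.

Definition smooth g : Prop :=
  (forall x, differentiable g x) /\ continuous (gradient g).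

Definition linearly_convergent (grad : 'rV[R]_d -> 'rV[R]_d) (rho C : R)
    (xs : nat -> 'rV[R]_d) : Prop :=
  forall t, enorm (grad (xs t)) <= C * enorm (grad (xs 0%N)) * rho ^+ t.

End euclidean.

Section conditioning.
Context {R : realType} {dO : measure_display} {Omega : measurableType dO}.
Variable P : probability Omega R.

Definition measurable_wrt {dT : measure_display} {T : measurableType dT}
    (A : set (set Omega)) (Z : Omega -> T) : Prop :=
  forall B, measurable B -> A (Z @^-1` B).

(* [W] is a version of the conditional expectation of the nonnegative extended
   random variable [Z] given the sub-sigma-algebra [A]. *)
Definition is_cond_expectation (A : set (set Omega)) (Z W : Omega -> \bar R)
    : Prop :=
  [/\ measurable_fun [set: Omega] Z /\ (forall w, 0 <= Z w)%E,
      measurable_wrt A W /\ (forall w, 0 <= W w)%E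
    & forall B, A B -> (\int[P]_(w in B) W w = \int[P]_(w in B) Z w)%E].

Definition cond_expectation_le (A : set (set Omega)) (Z : Omega -> \bar R)
    (c : R) : Prop :=
  exists2 W, is_cond_expectation A Z W & {ae P, forall w, (W w <= c%:E)%E}.

Context {dY : measure_display} {Y : measurableType dY}.

Definition mutually_independent (Yt : nat -> {RV P >-> Y}) : Prop :=
  forall (s : seq nat) (B : nat -> set Y),
    uniq s -> (forall j, measurable (B j)) ->
    P (\bigcap_(j in [set` s]) (Yt j @^-1` B j)) =
    (\prod_(j <- s) P (Yt j @^-1` B j))%E.

Definition iid_copies (PY : probability Y R) (Yt : nat -> {RV P >-> Y})
    : Prop :=
  mutually_independent Yt /\
  forall j B, measurable B -> distribution P (Yt j) B = PY B.

Definition sigma_first (Yt : nat -> {RV P >-> Y}) (n : nat)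
    : set (set Omega) :=
  <<s \bigcup_(j in `I_n) g_sigma_algebra_preimage (Yt j) >>.

End conditioning.

Section sample_average.
Context {R : realType} {d : nat} {dY : measure_display} {Y : measurableType dY}.
Variables (PY : probability Y R) (F : 'rV[R]_d -> Y -> R) (f : 'rV[R]_d -> R).

Record stochastic_problem : Prop := StochasticProblem {
  F_smooth : forall y, smooth (F ^~ y) ;
  F_integrable : forall x, PY.-integrable setT (EFin \o F x) ;
  f_expectation : forall x, 'E_PY[F x]%E = (f x)%:E ;
  f_differentiable : forall x, differentiable f x ;
  gradF_integrable : forall x i,
    PY.-integrable setT (fun y => (gradient (F ^~ y) x 0 i)%:E) ;
  gradF_unbiased : forall x i,
    'E_PY[fun y => (gradient (F ^~ y) x 0 i)%R]%E = (gradient f x 0 i)%:E }.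

(* The sample [Y_1, ..., Y_m] is [y 0, ..., y (m - 1)]. *)
Definition sample_f (m : nat) (y : nat -> Y) (x : 'rV[R]_d) : R :=
  m%:R^-1 * \sum_(j < m) F x (y j).

Definition sample_grad (m : nat) (y : nat -> Y) (x : 'rV[R]_d) : 'rV[R]_d :=
  m%:R^-1 *: \sum_(j < m) gradient (F ^~ (y j)) x.

Variable c0 : R.

Definition rel_err (x : 'rV[R]_d) (y : Y) : 'rV[R]_d :=
  (enorm (gradient f x) + c0)^-1 *: (gradient (F ^~ y) x - gradient f x).

Definition rel_err_env (y : Y) : \bar R :=
  ereal_sup (range (fun x => (enorm (rel_err x y))%:E)).

Definition sample_rel_err (m : nat) (y : nat -> Y) (x : 'rV[R]_d) : 'rV[R]_d :=
  (enorm (gradient f x) + c0)^-1 *: (sample_grad m y x - gradient f x).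

Definition sup_rel_err (m : nat) (y : nat -> Y) : \bar R :=
  ereal_sup (range (fun x => (enorm (sample_rel_err m y x))%:E)).

Definition sup_weighted_rel_err (alpha delta0 : R) (m : nat) (y : nat -> Y)
    : \bar R :=
  ereal_sup (range (fun x =>
    (enorm (sample_rel_err m y x)
       * (enorm (gradient f x) `^ alpha + delta0))%:E)).

End sample_average.

Section retrospective_approximation.
Context {R : realType} {d : nat} {dO dY : measure_display}
  {Omega : measurableType dO} {Y : measurableType dY}.
Variable P : probability Omega R.
Variables (F : 'rV[R]_d -> Y -> R) (Yt : nat -> {RV P >-> Y}).

(* [M k] is the sample size of iteration [k >= 1]; [M 0] is never used.  The
   sizes are non-random: a geometric schedule started at a constant. *)
Variable M : nat -> nat.

Definition samples_used (k : nat) : nat := (\sum_(1 <= i < k.+1) M i)%N.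

(* [Yt] is indexed from [0], so iteration [k] uses [Yt j] for
   [samples_used k.-1 <= j < samples_used k]. *)
Definition iter_sample (k : nat) (w : Omega) (j : nat) : Y :=
  Yt (samples_used k.-1 + j) w.

Definition RA_filtration (k : nat) : set (set Omega) :=
  sigma_first Yt (samples_used k).

Definition iter_f (k : nat) (w : Omega) : 'rV[R]_d -> R :=
  sample_f F (M k) (iter_sample k w).

Definition iter_grad (k : nat) (w : Omega) : 'rV[R]_d -> 'rV[R]_d :=
  sample_grad F (M k) (iter_sample k w).

(* [solver k g x t] is the [t]-th iterate of the solver of iteration [k] when
   it minimizes [g] from [x]; [Xin k w t] is the inner iterate X_{k-1,t}. *)
Record RA_run (solver : nat -> ('rV[R]_d -> R) -> 'rV[R]_d -> nat -> 'rV[R]_d)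
    (x0 : 'rV[R]_d) (eps : nat -> Omega -> R)
    (Xin : nat -> Omega -> nat -> 'rV[R]_d) (N : nat -> Omega -> nat)
    (X : nat -> Omega -> 'rV[R]_d) : Prop := RARun {
  solver_start : forall k g x, solver k g x 0%N = x ;
  RA_init : forall w, X 0%N w = x0 ;
  RA_inner : forall k w t, (1 <= k)%N ->
    Xin k w t = solver k (iter_f k w) (X k.-1 w) t ;
  RA_inner_measurable : forall k t i, (1 <= k)%N ->
    measurable_wrt (RA_filtration k) (fun w => Xin k w t 0 i) ;
  RA_stop : forall k w, (1 <= k)%N ->
    enorm (iter_grad k w (Xin k w (N k w))) <= eps k w /\
    (forall t, enorm (iter_grad k w (Xin k w t)) <= eps k w -> (N k w <= t)%N) ;
  RA_next : forall k w, (1 <= k)%N -> X k w = Xin k w (N k w) }.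

Definition oracle_calls (N : nat -> Omega -> nat) (k : nat) (w : Omega) : nat :=
  (\sum_(1 <= j < k.+1) N j w * M j)%N.

End retrospective_approximation.

(* Main.v *)
Require Import Defs.
From HB Require Import structures.
From mathcomp Require Import all_boot all_order all_algebra.
From mathcomp Require Import all_classical all_reals all_analysis.
From mathcomp Require Import measurable_realfun.
From mathcomp Require Import ring lra.
Import Order.TTheory GRing.Theory Num.Theory.
Import numFieldNormedType.Exports.
Local Open Scope classical_set_scope.
Local Open Scope ring_scope.

(** Everything is measured in the natural scale [M k ^ (1/2)].  Write [g_k] for
    the norm of the true gradient at the [k]-th output, [s_k] for the square
    root of [M k], and [r_k x] for the relative error of the sample gradient of
    iteration [k] at [x].  Two facts carry the proof.

    - Accuracy: the mean of [s_k * g_k] is bounded uniformly in [k].  At the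
      output the sample gradient is at most [eps_k = O(1 / s_k)], so by the
      triangle inequality [s_k * g_k <= c2 + (s_k * r_k) * (g_k + c0)].  Under
      a second moment bound on [g_k] the product [(s_k * r_k) * g_k] is split
      by the AM-GM inequality ([grad_bound_I]).  Under the moment bound on the
      weighted error it is absorbed instead: either [r_k < 1 / 2], or the
      weighted error is so large that a power of it already dominates
      [s_k * g_k] ([grad_bound_II]).

    - Work: the mean number of inner iterations is bounded uniformly in [k].
      When [N_k > 0], linear convergence bounds [(N_k - 1) * ln (1 / rho)] by
      the logarithm of a constant times [s_k * |grad f_(M_k) (X_(k-1))|], and
      the warm start [X_(k-1)] makes this sample gradient of order [1 / s_k].
      It is bounded by a product of factors depending separately on
      [s_k * g_(k-1)] and on [s_k * r_k]; the logarithm turns this product into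
      a sum ([iterations_le]), so that only separate moments of the past and of
      the new sample appear, never a joint one.

    Since the sample sizes grow geometrically, the work of the first [k]
    iterations has mean at most a constant times [M k] ([sum_schedule_le]).
    Choosing the least [k] with [s_k * e >= D], where [D] bounds the mean of
    [s_k * g_k], gives mean gradient norm at most [e] and makes [M k] of order
    [1 / e ^ 2].

    The random quantities evaluated along the run are bounded through upper
    expectations, i.e. integrals of measurable majorants; these majorants are
    built from the variables whose conditional moments are prescribed. *)

Set Implicit Arguments.
Unset Strict Implicit.
Unset Printing Implicit Defensive.

(** * The Euclidean norm *)

Section euclidean_norm.
Context {R : realType} {d : nat}.
Implicit Types (u v : 'rV[R]_d).

Lemma enorm_ge0 u : 0 <= enorm u. Proof. exact: sqrtr_ge0. Qed.

Lemma sqr_enorm u : enorm u ^+ 2 = \sum_(i < d) u 0 i ^+ 2.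
Proof. by rewrite sqr_sqrtr// sumr_ge0// => i _; exact: sqr_ge0. Qed.

Lemma enormZ (a : R) u : enorm (a *: u) = `|a| * enorm u.
Proof.
rewrite /enorm -sqrtr_sqr -sqrtrM ?sqr_ge0// mulr_sumr.
by congr Num.sqrt; apply: eq_bigr => i _; rewrite mxE exprMn.
Qed.

Lemma enorm0_eq0 u : enorm u = 0 -> u = 0.
Proof.
move=> u0; have := sqr_enorm u; rewrite u0 expr0n/= => /esym/eqP.
rewrite psumr_eq0 => [/allP u_i|i _]; last exact: sqr_ge0.
apply/rowP => i; rewrite mxE; apply/eqP; rewrite -sqrf_eq0.
exact: u_i (mem_index_enum i).
Qed.

Lemma ler_enormD u v : enorm (u + v) <= enorm u + enorm v.
Proof.
set s := enorm u; set t := enorm v.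
have s0 : 0 <= s := enorm_ge0 u; have t0 : 0 <= t := enorm_ge0 v.
have [/enorm0_eq0 u0|sN0] := eqVneq s 0.
  by rewrite u0 add0r -/t lerDr.
have [/enorm0_eq0 v0|tN0] := eqVneq t 0.
  by rewrite v0 addr0 -/s lerDl.
have st : 0 < s * t by rewrite mulr_gt0// lt0r ?sN0 ?tN0.
(* After multiplying the squared inequality by [s * t], it holds coordinate by
   coordinate: the difference of the two sides is a square. *)
rewrite -(ler_pXn2r (ltn0Sn 1)) ?nnegrE ?enorm_ge0 ?addr_ge0//.
rewrite -(ler_pM2l st) sqr_enorm mulr_sumr.
have -> : s * t * (s + t) ^+ 2
    = \sum_(i < d) (s + t) * (t * u 0 i ^+ 2 + s * v 0 i ^+ 2).
  rewrite -mulr_sumr big_split/= -!mulr_sumr -!sqr_enorm -/s -/t; ring.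
apply: ler_sum => i _; rewrite mxE -subr_ge0.
suff -> : (s + t) * (t * u 0 i ^+ 2 + s * v 0 i ^+ 2)
   - s * t * (u 0 i + v 0 i) ^+ 2 = (t * u 0 i - s * v 0 i) ^+ 2.
  exact: sqr_ge0.
ring.
Qed.

End euclidean_norm.

(** * Upper expectations *)

Section upper_expectation.
Context {R : realType} {dO : measure_display} {Omega : measurableType dO}.
Variable P : probability Omega R.
Implicit Types (u v : Omega -> R) (a b c : R).

(** The outer integral of [u] is at most [b].  Bounding through a measurable
    majorant lets suprema over [x] and quantities stopped at a random time be
    handled by pointwise inequalities alone. *)
Definition upper_expectation_le (u : Omega -> R) (b : R) : Prop :=
  exists Z : Omega -> \bar R,
    [/\ measurable_fun setT Z, (forall w, 0 <= Z w)%E,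
        (forall w, (u w)%:E <= Z w)%E & (\int[P]_w Z w <= b%:E)%E].

(** The integral of a nonnegative [u] is a supremum over the simple functions
    below [u], all of which lie below the majorant too. *)
Lemma expectation_le_upper u b : (forall w, 0 <= u w) ->
  upper_expectation_le u b -> ('E_P[u] <= b%:E)%E.
Proof.
move=> u0 [Z [_ Z0 uZ ZB]]; apply: le_trans ZB.
have u0' w : (0 <= (u w)%:E)%E by rewrite lee_fin.
rewrite unlock !ge0_integralTE//.
by apply: ereal_sup_le => _ [h hu <-]; exists h => // w; exact: le_trans (uZ w).
Qed.

Lemma le_upper_expectation u v b c : (forall w, u w <= v w) -> b <= c ->
  upper_expectation_le v b -> upper_expectation_le u c.
Proof.
move=> uv bc [Z [mZ Z0 vZ ZB]]; exists Z; split => // [w|].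
  by apply: le_trans (vZ w); rewrite lee_fin.
by apply: le_trans ZB _; rewrite lee_fin.
Qed.

Lemma upper_expectation_cst b : 0 <= b -> upper_expectation_le (fun=> b) b.
Proof.
move=> b0; exists (cst b%:E); split => [|w|//|].
- exact: measurable_cst.
- by rewrite lee_fin.
- by rewrite integral_cst//= probability_setT mule1.
Qed.

Lemma upper_expectationD u v b c : upper_expectation_le u b ->
  upper_expectation_le v c -> upper_expectation_le (fun w => u w + v w) (b + c).
Proof.
move=> [Z [mZ Z0 uZ ZB]] [V [mV V0 vV VB]].
exists (fun w => (Z w + V w)%E); split => [|w|w|].
- exact: emeasurable_funD.
- exact: adde_ge0.
- by rewrite EFinD; exact: leeD.
- by rewrite ge0_integralD// EFinD; exact: leeD.
Qed.

Lemma upper_expectationZ a u b : 0 <= a -> upper_expectation_le u b ->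
  upper_expectation_le (fun w => a * u w) (a * b).
Proof.
move=> a0 [Z [mZ Z0 uZ ZB]].
exists (fun w => (a%:E * Z w)%E); split => [|w|w|].
- exact: measurable_funeM.
- by apply: mule_ge0; rewrite ?lee_fin.
- by rewrite EFinM; apply: lee_wpmul2l; rewrite ?lee_fin.
- by rewrite ge0_integralZl_EFin// EFinM; apply: lee_wpmul2l; rewrite ?lee_fin.
Qed.

Lemma upper_expectation_sum (u : nat -> Omega -> R) (b : nat -> R) n :
  (forall j, (0 < j)%N -> upper_expectation_le (u j) (b j)) ->
  upper_expectation_le (fun w => \sum_(1 <= j < n.+1) u j w)
    (\sum_(1 <= j < n.+1) b j).
Proof.
move=> ub; elim: n => [|n IH].
  rewrite big_geq//.
  apply: le_upper_expectation (upper_expectation_cst (lexx 0)) => //.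
  by move=> w; rewrite big_geq.
rewrite big_nat_recr//=.
apply: le_upper_expectation (upper_expectationD IH (ub n.+1 _)) => // w.
by rewrite big_nat_recr.
Qed.

(** Integrating the version [W] of the conditional expectation over the whole
    space turns the conditional bound into a bound on the mean of [Z]. *)
Lemma upper_expectation_cond (A : set (set Omega)) Z b u :
  0 <= b -> A `<=` measurable -> A setT -> cond_expectation_le P A Z b ->
  (forall w, ((u w)%:E <= Z w)%E) -> upper_expectation_le u b.
Proof.
move=> b0 Am AT [W [[mZ Z0] [mW W0] WZ] Wb] uZ; exists Z; split => //.
rewrite -WZ//.
apply: (@le_trans _ _ (\int[P]_w (cst b%:E) w)%E); last first.
  by rewrite integral_cst//= probability_setT mule1.
apply: ae_ge0_le_integral => //.
- by move=> _ B mB; rewrite setTI; exact/Am/mW.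
- by apply: filterS Wb => w.
Qed.

End upper_expectation.

(** * Deterministic inequalities *)

Section deterministic_bounds.
Context {R : realType}.
Implicit Types (a alpha c delta e g kappa r rho s : R).

Lemma ler_1Dpow (x p : R) : 0 <= x -> 1 <= p -> x <= 1 + x `^ p.
Proof.
move=> x0 p1; have [x1|/ltW x1] := leP x 1.
  by rewrite (le_trans x1)// lerDl powR_ge0.
rewrite ler_wpDl// -[leLHS]powRr1//; exact: ler_powR.
Qed.

(** With [s] the root of the sample size, [e] the tolerance and [r] the relative
    error at the output: the cross term [(s * r) * g] is bounded by
    [(s * r) ^ 2 + g ^ 2], both of which have bounded mean. *)
Lemma grad_bound_I c0 c2 s g r e : 0 <= c0 -> 0 <= s -> s * e <= c2 ->
  g <= e + (g + c0) * r ->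
  s * g <= c2 + c0 + (c0 + 1) * (s * r) ^+ 2 + g ^+ 2.
Proof.
move=> c00 s0 se ger.
have sg : s * g <= c2 + (g + c0) * (s * r).
  rewrite (le_trans (ler_wpM2l s0 ger))// mulrDr lerD// mulrCA//.
have := sqr_ge0 (s * r - g); have := sqr_ge0 g; have := sqr_ge0 (s * r).
have sr2 : c0 * (s * r) <= c0 * (1 + (s * r) ^+ 2).
  apply: ler_wpM2l => //; have := sqr_ge0 (s * r - 1); nra.
nra.
Qed.

(** Put [h = s * (r * (g ^ alpha + delta))] and [p = 1 / alpha].  If
    [s * g <= (2 * h) ^ p] there is nothing to absorb.  Otherwise
    [2 * h < (s * g) ^ alpha <= s * g ^ alpha], which forces [r < 1 / 2], so the
    cross term [s * r * g] is at most half of [s * g]; the remaining term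
    [c0 * (s * r)] is controlled by [h / delta]. *)
Lemma grad_bound_II c0 c2 s g r e alpha delta :
  0 <= c0 -> 0 <= c2 -> 1 <= s -> 0 <= g -> 0 <= r ->
  0 < alpha < 1 -> 0 < delta ->
  s * e <= c2 -> g <= e + (g + c0) * r ->
  s * g <= 2 * c2 + 2 * c0 / delta + (2 * c0 / delta + 2 `^ alpha^-1)
             * (s * (r * (g `^ alpha + delta))) `^ alpha^-1.
Proof.
move=> c00 c20 s1 g0 r0 /andP[a0 a1] d0 se ger.
have s0 : 0 <= s := le_trans ler01 s1.
set h := s * (r * _); set p := alpha^-1.
have ga0 : 0 <= g `^ alpha := powR_ge0 _ _.
have h0 : 0 <= h by rewrite !mulr_ge0// addr_ge0// ltW.
have h20 : 0 <= 2 * h by exact: mulr_ge0.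
have hp0 : 0 <= h `^ p := powR_ge0 _ _.
have p1 : 1 <= p by rewrite invf_ge1// ltW.
set q := c0 / delta.
have q0 : 0 <= q by rewrite divr_ge0 ?mulr_ge0// ltW.
have -> : 2 * c0 / delta = 2 * q by rewrite mulrA.
have [sgh|hsg] := leP (s * g) ((2 * h) `^ p).
  rewrite powRM// in sgh; apply: le_trans sgh _.
  have : 0 <= q * h `^ p by exact: mulr_ge0.
  lra.
have g1 : 0 < g.
  rewrite lt0r g0 andbT; apply: contraTneq hsg => ->.
  by rewrite mulr0 -leNgt powR_ge0.
have h2 : 2 * h < s * g `^ alpha.
  have := gt0_ltr_powR a0 _ _ hsg; rewrite !nnegrE powR_ge0 mulr_ge0//.
  move=> /(_ isT isT).
  rewrite -powRrM mulVf ?gt_eqF// powRr1// => /lt_le_trans; apply.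
  rewrite powRM// ler_wpM2r// -[leRHS]powRr1//.
  by apply: ler_powR => //; exact: ltW.
have r2 : r < 2^-1.
  have gap : 0 < g `^ alpha := powR_gt0 _ g1.
  have : 0 < s * g `^ alpha by rewrite mulr_gt0// (lt_le_trans ltr01).
  have : 0 <= s * r * delta by rewrite !mulr_ge0// ltW.
  move: h2; rewrite /h; nra.
have srd : s * r <= (1 + h `^ p) / delta.
  rewrite ler_pdivlMr//; apply: le_trans (ler_1Dpow _ _) => //.
  by rewrite /h mulrA ler_wpM2l ?mulr_ge0// lerDr.
have sg : s * g <= c2 + g * (s * r) + c0 * (s * r).
  rewrite (le_trans (ler_wpM2l s0 ger))//; nra.
have csr : c0 * (s * r) <= q * (1 + h `^ p).
  by rewrite -mulrA [delta^-1 * _]mulrC; exact: ler_wpM2l.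
have sg2 : g * (s * r) <= s * g / 2.
  rewrite mulrCA mulrA ler_wpM2l ?mulr_ge0//; exact: ltW.
have : 0 <= 2 `^ p * h `^ p by rewrite mulr_ge0 ?powR_ge0.
lra.
Qed.

(** The hypothesis says that the linear rate has not yet brought a gradient of
    size [g + (g + c0) * r] down to tolerance after [n] steps.  The bound
    [s * (g + (g + c0) * r) <= (1 + s * g) * (1 + s * r) * (1 + g + c0)] and
    [1 + x <= exp x] separate [g] from [r] after taking logarithms. *)
Lemma iterations_le rho c0 kappa s g r (n : nat) :
  0 < rho -> 0 <= c0 -> 0 <= kappa -> 1 <= s -> 0 <= g -> 0 <= r ->
  1 < kappa * (s * (g + (g + c0) * r)) * rho ^+ n ->
  n%:R * ln rho^-1 <= kappa + c0 + 1 + 2 * (s * g) + (s * r) ^+ 2.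
Proof.
move=> rho0 c00 k0 s1 g0 r0 hn.
have s0 : 0 <= s := le_trans ler01 s1.
have sg0 : 0 <= s * g by exact: mulr_ge0.
have sr0 : 0 <= s * r by exact: mulr_ge0.
have gsg : g <= s * g by rewrite ler_peMl.
have sr2 : s * r <= 1 + (s * r) ^+ 2 by have := sqr_ge0 (s * r - 1); nra.
apply: (@le_trans _ _ (kappa + s * g + s * r + (g + c0))); last by lra.
rewrite -ler_expR expRM_natl lnK ?posrE ?invr_gt0//.
rewrite (expRD (_ + _ + _)) (expRD (_ + _)) (expRD kappa).
apply: (@le_trans _ _ (kappa * (s * (g + (g + c0) * r)))).
  by rewrite exprVn -[leLHS]mul1r ler_pdivrMr ?exprn_gt0// ltW.
have ex1 (x : R) : 0 <= x -> 0 <= 1 + x <= expR x.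
  by move=> x0; rewrite expR_ge1Dx addr_ge0.
apply: (@le_trans _ _
  ((1 + kappa) * (1 + s * g) * (1 + s * r) * (1 + (g + c0)))).
  rewrite -2!mulrA; apply: ler_pM => //.
  - by rewrite mulr_ge0// addr_ge0// mulr_ge0// addr_ge0.
  - by rewrite lerDr.
  - have : 0 <= s * g * (s * r) by rewrite mulr_ge0.
    have : 0 <= (s * g + s * r * (s * g)) * (g + c0).
      by rewrite mulr_ge0 ?addr_ge0 ?mulr_ge0.
    nra.
have /andP[? ?] := ex1 _ k0; have /andP[? ?] := ex1 _ sg0.
have /andP[? ?] := ex1 _ sr0; have /andP[? ?] := ex1 _ (addr_ge0 g0 c00).
by do 3!(apply: ler_pM => //; rewrite ?mulr_ge0//).
Qed.

End deterministic_bounds.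

(** * Relative errors of the sample gradient *)

Section relative_error.
Context {R : realType} {d : nat} {dY : measure_display} {Y : measurableType dY}.
Variables (F : 'rV[R]_d -> Y -> R) (f : 'rV[R]_d -> R) (c0 : R).
Hypothesis c0_gt0 : 0 < c0.
Variables (m : nat) (y : nat -> Y) (x : 'rV[R]_d).

Let g := enorm (gradient f x).
Let r := enorm (sample_rel_err F f c0 m y x).

Lemma sample_grad_subE :
  sample_grad F m y x - gradient f x = (g + c0) *: sample_rel_err F f c0 m y x.
Proof.
by rewrite scalerA divff ?scale1r// gt_eqF// ltr_wpDl// enorm_ge0.
Qed.

Lemma enorm_sample_grad_le : enorm (sample_grad F m y x) <= g + (g + c0) * r.
Proof.
rewrite -[sample_grad _ _ _ _](subrK (gradient f x)) addrC sample_grad_subE.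
rewrite (le_trans (ler_enormD _ _))// enormZ ger0_norm//.
by rewrite addr_ge0 ?enorm_ge0 ?ltW.
Qed.

Lemma enorm_gradient_le : g <= enorm (sample_grad F m y x) + (g + c0) * r.
Proof.
have {1}-> : g = enorm (sample_grad F m y x
                         + - (g + c0) *: sample_rel_err F f c0 m y x).
  by rewrite scaleNr -sample_grad_subE opprB addrC subrK.
rewrite (le_trans (ler_enormD _ _))// (enormZ (- _)) normrN ger0_norm//.
by rewrite addr_ge0 ?enorm_ge0 ?ltW.
Qed.

Lemma le_sup_rel_err : (r%:E <= sup_rel_err F f c0 m y)%E.
Proof. by apply: ereal_sup_ubound; exists x. Qed.

Lemma le_sup_weighted_rel_err alpha delta :
  ((r * (g `^ alpha + delta))%:E
    <= sup_weighted_rel_err F f c0 alpha delta m y)%E.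
Proof. by apply: ereal_sup_ubound; exists x. Qed.

End relative_error.

Lemma RA_filtration_sub {R : realType} {dO dY : measure_display}
    {Omega : measurableType dO} {Y : measurableType dY}
    (P : probability Omega R) (Yt : nat -> {RV P >-> Y}) (M : nat -> nat) k :
  RA_filtration Yt M k `<=` measurable.
Proof.
apply: smallest_sub; first exact: sigma_algebra_measurable.
move=> B [j _] [C mC <-].
exact: measurable_funPT (Yt j) _ _ mC.
Qed.

Lemma RA_filtrationT {R : realType} {dO dY : measure_display}
    {Omega : measurableType dO} {Y : measurableType dY}
    (P : probability Omega R) (Yt : nat -> {RV P >-> Y}) (M : nat -> nat) k :
  RA_filtration Yt M k setT.
Proof.
have [s0 sD _] := smallest_sigma_algebra setT
  (\bigcup_(j in `I_(samples_used M k)) g_sigma_algebra_preimage (Yt j)).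
by rewrite -[setT]setD0; exact: sD.
Qed.

(** * Geometric sample sizes *)

Section geometric_schedule.
Context {R : realType}.
Variables (c1 : R) (M : nat -> nat).
Hypotheses (c1_gt1 : 1 < c1) (M1_gt0 : (0 < M 1)%N).
Hypothesis MS : forall k, (2 <= k)%N -> (M k)%:R = c1 * (M k.-1)%:R.

(** Consecutive sizes are integers with ratio above one, so they increase by at
    least one; this is enough for unboundedness. *)
Lemma schedule_gt k : (k < M k.+1)%N.
Proof.
elim: k => [//|k IH]; apply: (leq_ltn_trans IH).
have Mk0 : (0 < M k.+1)%N by exact: leq_ltn_trans IH.
by rewrite -(ltr_nat R) (MS (k := k.+2))//= ltr_pMl// ltr0n.
Qed.

Lemma schedule_gt0 k : (0 < k)%N -> (0 < M k)%N.
Proof. by case: k => // k _; exact: leq_ltn_trans (schedule_gt k). Qed.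

Lemma sum_schedule_le k :
  \sum_(1 <= j < k.+1) (M j)%:R <= c1 / (c1 - 1) * (M k)%:R.
Proof.
have c10 : 0 < c1 - 1 by rewrite subr_gt0.
have c1_0 : 0 < c1 := lt_trans ltr01 c1_gt1.
have q1 : 1 <= c1 / (c1 - 1) by rewrite ler_pdivlMr// mul1r lerBlDr lerDl.
have q0 := le_trans ler01 q1.
elim: k => [|k IH]; first by rewrite big_geq// mulr_ge0.
case: k IH => [_|k IH].
  by rewrite big_nat1 ler_peMl.
rewrite big_nat_recr//= (le_trans (lerD IH (lexx _)))// (MS (k := k.+2))//=.
rewrite le_eqVlt; apply/orP; left; apply/eqP; field.
by rewrite gt_eqF.
Qed.

(** Take the least such [k].  Unless [k = 1], the previous size still fails, so
    the overshoot is at most the factor [c1]; the case [k = 1] accounts for the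
    second summand of the upper bound. *)
Lemma schedule_pick (D e : R) : 0 < e ->
  exists2 k, (0 < k)%N &
    D <= e * (M k)%:R /\ e * (M k)%:R <= c1 * `|D| + e * (M 1)%:R.
Proof.
move=> e0.
have exk : exists k, (0 < k)%N && (D <= e * (M k)%:R).
  exists (Num.bound `|D / e|).+1; rewrite /= -ler_pdivrMl// mulrC.
  apply: le_trans (ler_norm _) _.
  apply: le_trans (ltW (archi_boundP (normr_ge0 _))) _.
  rewrite ler_nat; exact/ltnW/schedule_gt.
case: (ex_minnP exk) => k /andP[k0 Dk] kmin; exists k => //; split => //.
case: k k0 Dk kmin => // -[_ _ _|k _ _ kmin].
  by rewrite lerDr mulr_ge0// (ltW (lt_trans ltr01 c1_gt1)).
have [//|lt_kD] := boolP (D <= e * (M k.+1)%:R).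
  by move=> h; have := kmin k.+1; rewrite h/= ltnn => /(_ isT).
rewrite -ltNge in lt_kD; rewrite (MS (k := k.+2))//= mulrCA.
apply: (@le_trans _ _ (c1 * `|D|)); last by rewrite lerDl mulr_ge0// ltW.
rewrite ler_pM2l ?(lt_trans ltr01)//.
by rewrite (le_trans (ltW lt_kD))// ler_norm.
Qed.
End geometric_schedule.

(** * Accuracy and work along the run *)

Section retrospective_approximation.
Context {R : realType} {d : nat} {dO dY : measure_display}
  {Omega : measurableType dO} {Y : measurableType dY}.
Variables (P : probability Omega R).
Variables (F : 'rV[R]_d -> Y -> R) (f : 'rV[R]_d -> R).
Variables (Yt : nat -> {RV P >-> Y}) (c0 : R) (M : nat -> nat).
Variables (c2lo c2 : R) (eps : nat -> Omega -> R).
Variables (solver : nat -> ('rV[R]_d -> R) -> 'rV[R]_d -> nat -> 'rV[R]_d).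
Variables (x0 : 'rV[R]_d) (Xin : nat -> Omega -> nat -> 'rV[R]_d).
Variables (N : nat -> Omega -> nat) (X : nat -> Omega -> 'rV[R]_d).
Hypotheses (c0_gt0 : 0 < c0) (c2lo_gt0 : 0 < c2lo).
Hypothesis M_gt0 : forall k, (1 <= k)%N -> (0 < M k)%N.
Hypothesis eps_bounds : forall k w, (1 <= k)%N ->
  c2lo <= Num.sqrt (M k)%:R * eps k w <= c2.
Hypothesis run : RA_run F Yt M solver x0 eps Xin N X.

Let rtM k : R := Num.sqrt (M k)%:R.
Let g k w := enorm (gradient f (X k w)).
Let r k w x := enorm (sample_rel_err F f c0 (M k) (iter_sample Yt M k w) x).

Let rel_err_moment_le sigma k :=
  cond_expectation_le P (RA_filtration Yt M k.-1)
    (fun w => (((Num.sqrt (M k)%:R)%R%:E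
       * sup_rel_err F f c0 (M k) (iter_sample Yt M k w)) ^+ 2)%E)
    (sigma ^+ 2).

Let weighted_moment_le alpha delta sigma k :=
  cond_expectation_le P (RA_filtration Yt M k.-1)
    (fun w => (((Num.sqrt (M k)%:R)%R%:E
       * sup_weighted_rel_err F f c0 alpha delta (M k)
           (iter_sample Yt M k w)) `^ alpha^-1)%E)
    (sigma `^ alpha^-1).

Lemma rtM_ge1 k : (1 <= k)%N -> 1 <= rtM k.
Proof.
by move=> k1; rewrite /rtM -[leLHS]sqrtr1 ler_sqrt ?ltr0n ?M_gt0// ler1n M_gt0.
Qed.

Lemma rtM_ge0 k : 0 <= rtM k. Proof. exact: sqrtr_ge0. Qed.

Lemma c2_ge0 : 0 <= c2.
Proof.
have /andP[h1 h2] := eps_bounds point (leqnn 1).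
exact: le_trans (ltW c2lo_gt0) (le_trans h1 h2).
Qed.

Lemma upper_expectation_RA k Z b u : 0 <= b ->
  cond_expectation_le P (RA_filtration Yt M k) Z b ->
  (forall w, ((u w)%:E <= Z w)%E) -> upper_expectation_le P u b.
Proof.
by move=> b0; apply: upper_expectation_cond => //;
  [exact: RA_filtration_sub|exact: RA_filtrationT].
Qed.

Lemma upper_expectation_rel_err sigma k (x : Omega -> 'rV[R]_d) :
  rel_err_moment_le sigma k ->
  upper_expectation_le P (fun w => (rtM k * r k w (x w)) ^+ 2) (sigma ^+ 2).
Proof.
move=> HG; apply: (upper_expectation_RA (sqr_ge0 _) HG) => w.
have s0 := rtM_ge0 k.
have r0 : 0 <= rtM k * r k w (x w) by rewrite mulr_ge0 ?enorm_ge0.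
have sr : ((rtM k * r k w (x w))%:E <= (rtM k)%:E
   * sup_rel_err F f c0 (M k) (iter_sample Yt M k w))%E.
  by rewrite EFinM lee_wpmul2l ?lee_fin//; exact: le_sup_rel_err.
by rewrite expe2 expr2 EFinM lee_pmul ?lee_fin.
Qed.

Lemma upper_expectation_weighted_rel_err alpha delta sigma k
    (x : Omega -> 'rV[R]_d) : 0 < alpha -> 0 < delta ->
  weighted_moment_le alpha delta sigma k ->
  upper_expectation_le P
    (fun w => (rtM k * (r k w (x w)
                * (enorm (gradient f (x w)) `^ alpha + delta))) `^ alpha^-1)
    (sigma `^ alpha^-1).
Proof.
move=> a0 d0 HH; apply: (upper_expectation_RA (powR_ge0 _ _) HH) => w.
set h := rtM k * _.
have h0 : 0 <= h.
  by rewrite !mulr_ge0 ?rtM_ge0 ?enorm_ge0 ?addr_ge0 ?powR_ge0 ?ltW.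
have hH : (h%:E <= (rtM k)%:E * sup_weighted_rel_err F f c0 alpha delta (M k)
           (iter_sample Yt M k w))%E.
  rewrite /h EFinM lee_wpmul2l ?lee_fin ?rtM_ge0//.
  exact: le_sup_weighted_rel_err.
rewrite -poweR_EFin; apply: gt0_ler_poweR => //.
- by rewrite invr_ge0 ltW.
- by rewrite in_itv/= lee_fin h0 leey.
- by rewrite in_itv/= leey (le_trans _ hH) ?lee_fin.
Qed.

(** The stopping rule controls the sample gradient at the output; the relative
    error converts this into a bound, still implicit, on the true gradient. *)
Lemma gradient_output_le k w : (1 <= k)%N ->
  g k w <= eps k w + (g k w + c0) * r k w (X k w).
Proof.
move=> k1; have [stop _] := RA_stop run w k1.
rewrite -(RA_next run w k1) in stop.
apply: le_trans (enorm_gradient_le F f c0_gt0 (M k) (iter_sample Yt M k w) _) _.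
by rewrite lerD2r.
Qed.

Lemma gradient_mean_I sigma ell k : (1 <= k)%N ->
  rel_err_moment_le sigma k ->
  cond_expectation_le P (RA_filtration Yt M k.-1)
    (fun w => (enorm (gradient f (X k w)) ^+ 2)%:E) (ell ^+ 2) ->
  upper_expectation_le P (fun w => rtM k * g k w)
    (c2 + c0 + (c0 + 1) * sigma ^+ 2 + ell ^+ 2).
Proof.
move=> k1 HG Hell.
have c20 := c2_ge0.
have U1 := upper_expectation_rel_err (X k) HG.
have U2 := upper_expectation_RA (sqr_ge0 _) Hell (fun w => lexx _).
have c01 : 0 <= c0 + 1 by rewrite addr_ge0// ltW.
have U := upper_expectationD (upper_expectationD
  (upper_expectation_cst P (addr_ge0 c20 (ltW c0_gt0)))
  (upper_expectationZ c01 U1)) U2.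
apply: le_upper_expectation (lexx _) U => w.
apply: (@grad_bound_I _ _ _ _ _ (r k w (X k w)) (eps k w)).
- exact: ltW.
- exact: rtM_ge0.
- by case/andP: (eps_bounds w k1).
- exact: gradient_output_le.
Qed.

Lemma gradient_mean_II alpha delta sigma k : (1 <= k)%N ->
  0 < alpha < 1 -> 0 < delta ->
  weighted_moment_le alpha delta sigma k ->
  upper_expectation_le P (fun w => rtM k * g k w)
    (2 * c2 + 2 * c0 / delta
       + (2 * c0 / delta + 2 `^ alpha^-1) * sigma `^ alpha^-1).
Proof.
move=> k1 a01 d0 HH; have [a0 a1] := andP a01.
have c20 := c2_ge0.
have cd0 : 0 <= 2 * c0 / delta by rewrite divr_ge0 ?mulr_ge0// ltW.
have U1 := upper_expectation_weighted_rel_err (X k) a0 d0 HH.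
have U := upper_expectationD
  (upper_expectation_cst P (addr_ge0 (mulr_ge0 (ler0n _ 2) c20) cd0))
  (upper_expectationZ (addr_ge0 cd0 (powR_ge0 2 alpha^-1)) U1).
apply: le_upper_expectation (lexx _) U => w.
apply: (@grad_bound_II _ _ _ _ _ _ (eps k w)) => //.
- exact: ltW.
- exact: rtM_ge1.
- exact: enorm_ge0.
- exact: enorm_ge0.
- by case/andP: (eps_bounds w k1).
- exact: gradient_output_le.
Qed.

Variables (rho C : R) (rhoM CM : nat -> Omega -> R).
Hypothesis rho_lt1 : rho < 1.
Hypothesis rhoM_le : forall k w, (1 <= k)%N -> 0 < rhoM k w <= rho.
Hypothesis CM_le : forall k w, (1 <= k)%N -> CM k w <= C.
Hypothesis solver_linear : forall k w, (1 <= k)%N ->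
  linearly_convergent (iter_grad F Yt M k w) (rhoM k w) (CM k w) (Xin k w).

Let L := ln rho^-1.
(* Linear convergence constant over the least scaled tolerance; [1 + |C|] is
   nonnegative and above [C] whatever the sign of [C]. *)
Let kappa := (1 + `|C|) / c2lo.

Lemma rho_gt0 : 0 < rho.
Proof.
by have /andP[h1 h2] := rhoM_le point (leqnn 1); exact: lt_le_trans h2.
Qed.

Lemma L_gt0 : 0 < L.
Proof. by rewrite ln_gt0// invf_gt1// rho_gt0. Qed.

Lemma kappa_ge0 : 0 <= kappa.
Proof. by rewrite divr_ge0 ?addr_ge0// ltW. Qed.

(** If [N k] is positive, the inner iterate just before it misses the tolerance,
    so [iterations_le] applies with [n = N k - 1]; the leading [L] pays for the
    last step. *)
Lemma RA_iterations_le k w : (1 <= k)%N ->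
  (N k w)%:R * L <= L + (kappa + c0 + 1) + 2 * (rtM k * g k.-1 w)
     + (rtM k * r k w (X k.-1 w)) ^+ 2.
Proof.
move=> k1.
have kappa0 := kappa_ge0.
have g0 : 0 <= g k.-1 w := enorm_ge0 _.
have r0 : 0 <= r k w (X k.-1 w) := enorm_ge0 _.
have s1 := rtM_ge1 k1.
have c00 := ltW c0_gt0.
case EN : (N k w) => [|n].
  have L0 := ltW L_gt0.
  rewrite mul0r addr_ge0 ?sqr_ge0//.
  rewrite addr_ge0 ?(mulr_ge0 (ler0n _ 2)) ?mulr_ge0 ?rtM_ge0//.
  by rewrite !addr_ge0.
rewrite -[n.+1]addn1 natrD mulrDl mul1r addrC -!addrA lerD2l !addrA.
apply: (iterations_le rho_gt0) => //.
have [_ Nmin] := RA_stop run w k1.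
have : eps k w < enorm (iter_grad F Yt M k w (Xin k w n)).
  by rewrite ltNge; apply/negP => /Nmin; rewrite EN ltnn.
have Xin0 : Xin k w 0%N = X k.-1 w.
  by rewrite (RA_inner run)// (solver_start run).
have := solver_linear w k1 n; rewrite Xin0.
set G := enorm (iter_grad _ _ _ _ _ (X _ _)); set Gn := enorm _ => GnG epsGn.
have G0 : 0 <= G := enorm_ge0 _.
have Gle : G <= g k.-1 w + (g k.-1 w + c0) * r k w (X k.-1 w).
  exact: enorm_sample_grad_le.
have /andP[rk0 rk] := rhoM_le w k1.
have rn : 0 <= rhoM k w ^+ n <= rho ^+ n.
  have rk_ge0 := ltW rk0.
  by rewrite exprn_ge0//= lerXn2r ?nnegrE// (le_trans rk_ge0).
have GnG' : Gn <= (1 + `|C|) * G * rho ^+ n.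
  apply: le_trans GnG _.
  have CG : CM k w * G <= (1 + `|C|) * G.
    rewrite ler_wpM2r// (le_trans (CM_le w k1))//.
    by rewrite (le_trans (ler_norm _))// lerDr.
  case/andP: rn => rn0 rn; apply: le_trans (ler_wpM2r rn0 CG) _.
  by rewrite ler_wpM2l// mulr_ge0// addr_ge0.
have /andP[ec _] := eps_bounds w k1.
have s0 : 0 < rtM k := lt_le_trans ltr01 s1.
rewrite /kappa.
set G' := g k.-1 w + _ in Gle *.
have -> : (1 + `|C|) / c2lo * (rtM k * G') * rho ^+ n
    = rtM k * ((1 + `|C|) * G' * rho ^+ n) / c2lo by ring.
rewrite ltr_pdivlMr// mul1r (le_lt_trans ec)//.
rewrite ltr_pM2l// (lt_le_trans epsGn)// (le_trans GnG')//.
rewrite ler_wpM2r ?exprn_ge0 ?(ltW rho_gt0)// ler_wpM2l// addr_ge0//.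
Qed.

Variables (c1 sigma D : R).
Hypothesis c1_gt1 : 1 < c1.
Hypothesis MS : forall k, (2 <= k)%N -> (M k)%:R = c1 * (M k.-1)%:R.
Hypothesis HG : forall k, (1 <= k)%N -> rel_err_moment_le sigma k.
Hypothesis D_ge0 : 0 <= D.
Hypothesis gradient_mean : forall k, (1 <= k)%N ->
  upper_expectation_le P (fun w => rtM k * g k w) D.

(* One constant for both kinds of start: [x0] when [k = 1], and the previous
   output rescaled by [s_k / s_(k-1) = c1 ^ (1/2)] when [k > 1]. *)
Let G0 := rtM 1 * enorm (gradient f x0) + Num.sqrt c1 * D.

Lemma G0_ge0 : 0 <= G0.
Proof. by rewrite addr_ge0// mulr_ge0 ?rtM_ge0 ?enorm_ge0 ?sqrtr_ge0. Qed.

(** The gradient at the starting point of iteration [k] is already of the order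
    [1 / s_k] of the target tolerance, because [s_k] and [s_(k-1)] are
    comparable.  This is why the iteration counts stay bounded. *)
Lemma warm_start_mean k : (1 <= k)%N ->
  upper_expectation_le P (fun w => rtM k * g k.-1 w) G0.
Proof.
case: k => // -[_|k _] /=.
  apply: le_upper_expectation (upper_expectation_cst P G0_ge0) => // w.
  by rewrite /g (RA_init run) lerDl mulr_ge0 ?sqrtr_ge0.
have sM : rtM k.+2 = Num.sqrt c1 * rtM k.+1.
  by rewrite /rtM (MS (k := k.+2))// sqrtrM// (le_trans ler01)// ltW.
apply: le_upper_expectation
  (upper_expectationZ (sqrtr_ge0 c1) (gradient_mean (ltn0Sn k))).
- by move=> w; rewrite sM mulrA.
- by rewrite lerDr mulr_ge0 ?rtM_ge0 ?enorm_ge0.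
Qed.

Let B := L^-1 * (L + (kappa + c0 + 1) + 2 * G0 + sigma ^+ 2).

Lemma iterations_mean k : (1 <= k)%N ->
  upper_expectation_le P (fun w => (N k w)%:R) B.
Proof.
move=> k1.
have b0 : 0 <= L + (kappa + c0 + 1).
  by rewrite !addr_ge0 ?kappa_ge0 ?(ltW L_gt0)// ltW.
have U := upper_expectationD (upper_expectationD (upper_expectation_cst P b0)
  (upper_expectationZ (ler0n _ 2) (warm_start_mean k1)))
  (upper_expectation_rel_err (X k.-1) (HG k1)).
have Li : 0 <= L^-1 by rewrite invr_ge0 ltW// L_gt0.
apply: le_upper_expectation (upper_expectationZ Li U) => // w.
by rewrite mulrC ler_pdivlMr ?L_gt0//; exact: RA_iterations_le.
Qed.

Lemma oracle_calls_mean k :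
  upper_expectation_le P (fun w => (oracle_calls M N k w)%:R)
    (B * (c1 / (c1 - 1) * (M k)%:R)).
Proof.
have B0 : 0 <= B.
  rewrite mulr_ge0 ?invr_ge0 ?(ltW L_gt0)// !addr_ge0 ?sqr_ge0//.
  - exact/ltW/L_gt0.
  - exact: kappa_ge0.
  - exact: ltW.
  - by rewrite mulr_ge0// G0_ge0.
have U := upper_expectation_sum k
  (fun j j0 => upper_expectationZ (ler0n R (M j)) (iterations_mean j0)).
apply: le_upper_expectation U => [w|].
  by rewrite natr_sum; apply: ler_sum => j _; rewrite natrM mulrC.
rewrite -mulr_suml mulrC ler_wpM2l//; exact: (sum_schedule_le c1_gt1 MS).
Qed.

Lemma suboptimality_and_cost : exists K : R,
  forall e : R, 0 < e < 1 -> exists k : nat, [/\ (1 <= k)%N,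
    ('E_P[fun w => (enorm (gradient f (X k w)))%R] <= e%:E)%E
  & ('E_P[fun w => ((oracle_calls M N k w)%:R)%R] <= (K / e ^+ 2)%:E)%E].
Proof.
exists (`|B * (c1 / (c1 - 1))| * (c1 * `|D ^+ 2| + (M 1)%:R)) => e /andP[e0 e1].
have e20 : 0 < e ^+ 2 by rewrite exprn_gt0.
(* Squared form of [D <= s_k * e] for the accuracy; the upper bound on
   [e ^ 2 * M k] is then at most [c1 * D ^ 2 + M 1] because [e < 1]. *)
have [k k1 [Dk kD]] := schedule_pick c1_gt1 (M_gt0 (leqnn 1)) MS (D ^+ 2) e20.
exists k; split => //.
  have s0 : 0 < rtM k := lt_le_trans ltr01 (rtM_ge1 k1).
  have si : 0 <= (rtM k)^-1 by rewrite invr_ge0 ltW.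
  apply: expectation_le_upper => [w|]; first exact: enorm_ge0.
  apply: le_upper_expectation (upper_expectationZ si (gradient_mean k1)).
    by move=> w; rewrite mulKf ?lexx// gt_eqF.
  rewrite mulrC ler_pdivrMr//.
  rewrite -(ler_pXn2r (ltn0Sn 1)) ?nnegrE ?mulr_ge0 ?(ltW e0) ?(ltW s0)//.
  by rewrite exprMn sqr_sqrtr.
apply: expectation_le_upper => [w|]; first exact: ler0n.
apply: le_upper_expectation (oracle_calls_mean k) => //.
rewrite mulrA; apply: le_trans (ler_wpM2r _ (ler_norm _)) _ => //.
rewrite -[leRHS]mulrA ler_wpM2l// ler_pdivlMr// mulrC (le_trans kD)// lerD2l.
by rewrite ler_piMl// exprn_ile1// ltW.
Qed.

End retrospective_approximation.

(** * The oracle complexity *)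

Unset Implicit Arguments.

Theorem theorem5
  (R : realType) (d : nat) (dO dY : measure_display)
  (Omega : measurableType dO) (Y : measurableType dY)
  (P : probability Omega R) (PY : probability Y R)
  (F : 'rV[R]_d -> Y -> R) (f : 'rV[R]_d -> R)
  (Hproblem : stochastic_problem PY F f)
  (Yt : nat -> {RV P >-> Y}) (Hiid : iid_copies PY Yt)
  (c0 : R) (Hc0 : 0 < c0)
  (m1 : nat) (Hm1 : (0 < m1)%N)
  (c1 : R) (Hc1 : 1 < c1)
  (M : nat -> nat) (HM1 : M 1%N = m1)
  (HM : forall k, (2 <= k)%N -> (M k)%:R = c1 * (M k.-1)%:R)
  (c2lo c2 : R) (Hc2lo : 0 < c2lo) (Hc2 : c2lo <= c2)
  (C2 : nat -> Omega -> R)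
  (HC2 : forall k w, (1 <= k)%N -> c2lo <= C2 k w <= c2)
  (HC2m : forall k, (1 <= k)%N -> measurable_wrt (RA_filtration Yt M k.-1) (C2 k))
  (eps : nat -> Omega -> R)
  (Heps : forall k w, (1 <= k)%N -> eps k w = C2 k w / Num.sqrt (M k)%:R)
  (solver : nat -> ('rV[R]_d -> R) -> 'rV[R]_d -> nat -> 'rV[R]_d)
  (x0 : 'rV[R]_d)
  (Xin : nat -> Omega -> nat -> 'rV[R]_d)
  (N : nat -> Omega -> nat) (X : nat -> Omega -> 'rV[R]_d)
  (HRA : RA_run F Yt M solver x0 eps Xin N X)
  (rho C : R) (Hrho : rho < 1)
  (rhoM CM : nat -> Omega -> R)
  (HrhoM : forall k w, (1 <= k)%N -> 0 < rhoM k w <= rho)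
  (HCM : forall k w, (1 <= k)%N -> CM k w <= C)
  (Hlin : forall k w, (1 <= k)%N ->
    linearly_convergent (iter_grad F Yt M k w) (rhoM k w) (CM k w) (Xin k w))
  (sigma : R) (Hsigma : 0 <= sigma)
  (HG : forall k, (1 <= k)%N ->
    cond_expectation_le P (RA_filtration Yt M k.-1)
      (fun w => (((Num.sqrt (M k)%:R)%R%:E
         * sup_rel_err F f c0 (M k) (iter_sample Yt M k w)) ^+ 2)%E)
      (sigma ^+ 2))
  (A : R)
  (Hcase :
    (exists ell : R,
      [/\ 0 <= ell,
          {ae P, forall w,
            sup_rel_err F f c0 m (fun j => Yt j w) @[m --> \oo] --> 0%E},
          (\int[PY]_y (rel_err_env F f c0 y) ^+ 2 < +oo)%E,
          (forall k, (1 <= k)%N ->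
             cond_expectation_le P (RA_filtration Yt M k.-1)
               (fun w => (enorm (gradient f (X k w)) ^+ 2)%:E) (ell ^+ 2))
        & A = Num.sqrt c1 * (c2 + c0 * sigma + sigma * ell)
                / Num.sqrt m1%:R])
    \/
    (exists alpha delta0 sigma0 : R,
      [/\ 0 < alpha < 1, 0 < delta0, 0 <= sigma0,
          (forall k, (1 <= k)%N ->
             cond_expectation_le P (RA_filtration Yt M k.-1)
               (fun w => (((Num.sqrt (M k)%:R)%R%:E
                  * sup_weighted_rel_err F f c0 alpha delta0 (M k)
                      (iter_sample Yt M k w)) `^ alpha^-1)%E)
               (sigma0 `^ alpha^-1))
        & let kappa2 := 2 * (1 - alpha)
              * (2 * alpha / (1 - alpha)) `^ alpha * sigma0 in
          A = Num.sqrt c1 * (2 * (c2 + c0 * sigma0 / delta0) / Num.sqrt m1%:R)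
                + (kappa2 / Num.sqrt m1%:R) `^ alpha^-1])) :
  exists K e0 : R, 0 < e0 /\
    forall e : R, 0 < e < e0 ->
      exists k : nat, [/\ (1 <= k)%N,
        ('E_P[fun w => (enorm (gradient f (X k w)))%R] <= e%:E)%E
      & ('E_P[fun w => ((oracle_calls M N k w)%:R)%R]
           <= (K * (A ^+ 2 * m1%:R
                    / ((c1 - 1) * e ^+ 2 * ln (rho^-1))))%R%:E)%E].
Proof.
have M1_gt0 : (0 < M 1)%N by rewrite HM1.
have M_gt0 := schedule_gt0 Hc1 M1_gt0 HM.
have c2_gt0 : 0 < c2 := lt_le_trans Hc2lo Hc2.
have c1_gt0 : 0 < c1 := lt_trans ltr01 Hc1.
have eps_bounds k w : (1 <= k)%N -> c2lo <= Num.sqrt (M k)%:R * eps k w <= c2.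
  move=> k1; rewrite Heps// mulrCA divff ?mulr1 ?HC2//.
  by rewrite gt_eqF// sqrtr_gt0 ltr0n M_gt0.
have m1_gt0 : 0 < m1%:R :> R by rewrite ltr0n.
have sm_gt0 : 0 < Num.sqrt m1%:R :> R by rewrite sqrtr_gt0.
have sc_gt0 : 0 < Num.sqrt c1 by rewrite sqrtr_gt0.
have [D [D0 A0 HD]] : exists D, [/\ 0 <= D, 0 < A & forall k, (1 <= k)%N ->
    upper_expectation_le P
      (fun w => Num.sqrt (M k)%:R * enorm (gradient f (X k w))) D].
  case: Hcase => [[ell [ell0 _ _ Hell ->]]|
                  [alpha [delta [sigma0 [a01 d0 s00 HH]]]]].
  - exists (c2 + c0 + (c0 + 1) * sigma ^+ 2 + ell ^+ 2); split.
    + by rewrite !addr_ge0 ?mulr_ge0 ?sqr_ge0 ?addr_ge0// ltW.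
    + rewrite divr_gt0// mulr_gt0// !ltr_wpDr ?mulr_ge0//; exact: ltW.
    + move=> k k1; exact: (gradient_mean_I Hc0 Hc2lo eps_bounds HRA k1
        (HG k k1) (Hell k k1)).
  - move=> /= ->; exists (2 * c2 + 2 * c0 / delta
       + (2 * c0 / delta + 2 `^ alpha^-1) * sigma0 `^ alpha^-1); split.
    + have cd : 0 <= 2 * c0 / delta by rewrite divr_ge0 ?mulr_ge0// ltW.
      rewrite addr_ge0//; first by rewrite addr_ge0// mulr_ge0// ltW.
      by rewrite mulr_ge0 ?powR_ge0// addr_ge0 ?powR_ge0.
    + rewrite ltr_wpDr ?powR_ge0// mulr_gt0// divr_gt0// mulr_gt0//.
      by rewrite ltr_wpDr// divr_ge0 ?mulr_ge0// ltW.
    + move=> k k1.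
      exact: (gradient_mean_II Hc0 Hc2lo M_gt0 eps_bounds HRA k1 a01 d0
        (HH k k1)).
(* As [A] is positive, the target is a fixed positive multiple of [1 / e ^ 2],
   and the factor is absorbed into the constant. *)
have [K HK] := suboptimality_and_cost Hc0 Hc2lo M_gt0 eps_bounds HRA Hrho HrhoM
  HCM Hlin Hc1 HM HG D0 HD.
have rho0 : 0 < rho := rho_gt0 HrhoM.
have L0 : 0 < ln rho^-1 by rewrite ln_gt0// invf_gt1.
have c10 : 0 < c1 - 1 by rewrite subr_gt0.
exists (K * ((c1 - 1) * ln rho^-1 / (A ^+ 2 * m1%:R))), 1; split => // e e01.
have [k [k1 Ek Wk]] := HK e e01; exists k; split => //.
have e0 : 0 < e by case/andP: e01.
apply: le_trans Wk _; rewrite lee_fin le_eqVlt; apply/orP; left; apply/eqP.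
by field; rewrite !gt_eqF ?mulr_gt0.
Qed.
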